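(* Let $\Omega\subset\mathbb{R}^2$ be a bounded domain and let $\psi\in C^0(\partial\Omega)$ be the restriction to $\partial\Omega$ of an affine function on $\mathbb{R}^2$. If $u\in C^2(\Omega)\cap C^0(\overline\Omega)$ is a solution of the Dirichlet problem $$Q(u)=0\ \text{ in }\Omega,\qquad |Du|<1\ \text{ in }\Omega,\qquad u=\psi\ \text{ on }\partial\Omega,$$ where $$Q(u)=\mathrm{div}\left(\frac{Du}{\sqrt{1-|Du|^2}}\right)-\mathrm{div}\left(\frac{Du}{\sqrt{1+|Du|^2}}\right),$$ then $u$ is an affine function.
   Context: A domain is a connected open set; $D$, $|\cdot|$ and $\mathrm{div}$ are the Euclidean gradient, norm and divergence in $\mathbb{R}^2$. The equation $Q(u)=0$ is called the $H_R=H_L$ surface equation. *)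

(* Defs.v *)
From HB Require Import structures.
From mathcomp Require Import all_boot all_order all_algebra.
From mathcomp Require Import all_classical all_reals all_analysis.

Set Implicit Arguments.
Unset Strict Implicit.
Unset Printing Implicit Defensive.

Import Order.TTheory GRing.Theory Num.Theory.
Import numFieldNormedType.Exports.

Local Open Scope classical_set_scope.
Local Open Scope ring_scope.

(* Points of R^n are row vectors.  The library norm `|.| on 'rV[R]_n is the
   sup norm; it induces the usual topology and bounded sets, and the Euclidean
   norm is [enorm] below.  Functions on a subset of R^n are total functions
   whose values outside the subset are irrelevant. *)
Section Euclidean.
Context {R : realType} {n : nat}.
Implicit Types (A : set 'rV[R]_n) (f : 'rV[R]_n -> R)
  (F : 'rV[R]_n -> 'rV[R]_n).

Definition enorm (v : 'rV[R]_n) : R := Num.sqrt (\sum_(i < n) v ord0 i ^+ 2).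

Definition partial (i : 'I_n) f : 'rV[R]_n -> R :=
  fun x => 'D_(delta_mx ord0 i) f x.

Definition grad f : 'rV[R]_n -> 'rV[R]_n := fun x => \row_i partial i f x.

Definition divergence F : 'rV[R]_n -> R :=
  fun x => \sum_(i < n) partial i (fun y => F y ord0 i) x.

(* The class C^k(A), for A open: all iterated partial derivatives of order at
   most k exist and are continuous on A. *)
Fixpoint Ck (k : nat) A f : Prop :=
  {within A, continuous f} /\
  if k is k'.+1 then
    forall i : 'I_n,
      (forall x, A x -> derivable f x (delta_mx ord0 i)) /\
      Ck k' A (partial i f)
  else True.

Definition is_domain A : Prop := open A /\ connected A.

Definition boundary A : set 'rV[R]_n := closure A `\` A°.

Definition affine_fun f : Prop :=
  exists (a : 'rV[R]_n) (c : R),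
    forall x, f x = \sum_(i < n) a ord0 i * x ord0 i + c.

Definition restricts_affine A f : Prop :=
  exists2 l, affine_fun l & {in A, f =1 l}.

End Euclidean.

Definition Q {R : realType} (u : 'rV[R]_2 -> R) : 'rV[R]_2 -> R := fun x =>
  divergence (fun y => (Num.sqrt (1 - enorm (grad u y) ^+ 2))^-1 *: grad u y) x
  - divergence (fun y => (Num.sqrt (1 + enorm (grad u y) ^+ 2))^-1 *: grad u y)
      x.

(* Main.v *)
Require Import Defs.
From HB Require Import structures.
From mathcomp Require Import all_boot all_order all_algebra.
From mathcomp Require Import all_classical all_reals all_analysis.
From mathcomp Require Import ring lra.

Set Implicit Arguments.
Unset Strict Implicit.
Unset Printing Implicit Defensive.

Import Order.TTheory GRing.Theory Num.Theory.
Import numFieldNormedType.Exports.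
Local Open Scope classical_set_scope.
Local Open Scope ring_scope.

(** Write $Du = p$, $H = D^2 u$, $S = \sqrt{1-|p|^2}$, $T = \sqrt{1+|p|^2}$.
    Expanding the two divergences ([Q_expand]) gives
    $$Q(u) = (1/S - 1/T)\,\mathrm{tr} H + (1/S^3 + 1/T^3)\, p^T H p,$$
    a quasilinear operator without terms of order zero or one, elliptic except
    where $p = 0$: there both terms vanish.  Hence $sQ(u) < 0$ wherever
    $p \neq 0$ and $sH$ is negative definite ([Q_neg_of_hessian_neg]).

    Let $l$ be affine with $u = l$ on the boundary, and suppose that
    $v = s(u - l)$, with $s = \pm 1$, is positive somewhere.  Adding to $v$ a
    small paraboloid $\varepsilon|x|^2 + k x_0$ keeps the maximum over the
    closure of the domain at an interior point $x_1$.  First and second order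
    conditions there ([paraboloid_contact]) give $sH \le -2\varepsilon I$ and
    $s p_0 = s a_0 - k - 2\varepsilon x_{1,0}$, where $a$ is the gradient of
    $l$.  The strictly convex term makes $sH$ negative definite, and the linear
    term keeps $x_1$ off the degenerate set: with $|k| = 4\varepsilon K$, where
    $K$ bounds the coordinates on the domain, and the sign of $k$ opposite to
    that of $s a_0$, the number $s p_0$ cannot vanish.  So $sQ(u)(x_1) < 0$,
    contradicting the equation ([one_sided_comparison]).  Using both signs of
    $s$, one gets $u = l$.

    The second order condition is needed in the direction $p$, whereas
    the class $C^2$ is expressed by partial derivatives along the axes;
    [Ck1_is_derive] provides the derivatives in all directions. *)

(** * Derivatives along lines *)

(** Restriction to a line turns a directional derivative into an ordinary one,
    so that the one-variable chain rule, mean value theorem and extremum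
    conditions apply. *)
Lemma is_derive_lineE (R : realType) (V : normedModType R) (f : V -> R)
    (x v : V) (t d : R) :
  is_derive t 1 (fun h : R => f (h *: v + x)) d <-> is_derive (t *: v + x) v f d.
Proof.
have eqg : (fun h : R => h^-1 *: (((fun k : R => f (k *: v + x)) \o shift t) (h *: 1)
        - f (t *: v + x)))
   = (fun h => h^-1 *: ((f \o shift (t *: v + x)) (h *: v) - f (t *: v + x))).
  apply/funext => h /=; congr (_ *: (f _ - _)).
  by rewrite scalerDl addrA [_%:A]mulr1.
have eqD : 'D_1 (fun h : R => f (h *: v + x)) t = 'D_v f (t *: v + x).
  by rewrite /derive -eqg.
have eqC : derivable (fun h : R => f (h *: v + x)) t 1 =
           derivable f (t *: v + x) v.
  by rewrite /derivable -eqg.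
split=> -[dfx fx]; apply: DeriveDef.
- by rewrite -eqC.
- by rewrite -eqD.
- by rewrite eqC.
- by rewrite eqD.
Qed.

Lemma is_derive_comp_real (R : realType) (V : normedModType R)
    (g : R -> R) (f : V -> R) (x v : V) (a b : R) :
  is_derive (f x) 1 g a -> is_derive x v f b -> is_derive x v (g \o f) (a * b).
Proof.
move=> dg df; have := is_derive_lineE (g \o f) x v 0 (a * b).
rewrite scale0r add0r => -[+ _]; apply.
apply: (@is_derive1_comp _ g (fun h : R => f (h *: v + x))).
  by rewrite scale0r add0r.
by apply/is_derive_lineE; rewrite scale0r add0r.
Qed.

Lemma is_derive_scale_dir (R : realType) (V : normedModType R) (f : V -> R)
    (x v : V) (c d : R) : is_derive x v f d -> is_derive x (c *: v) f (c * d).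
Proof.
move=> df; have := is_derive_lineE f x (c *: v) 0 (c * d).
rewrite scale0r add0r => -[+ _]; apply.
have -> : (fun h : R => f (h *: (c *: v) + x)) =
          (fun k : R => f (k *: v + x)) \o (fun h : R => h * c).
  by apply/funext => h /=; rewrite scalerA.
rewrite mulrC; apply: is_derive1_comp.
  by apply/is_derive_lineE; rewrite mul0r scale0r add0r.
have -> : (fun h : R => h * c) = c *: (@id R).
  by apply/funext => h /=; rewrite mulrC.
by apply: is_derive_eq; rewrite [_ *: _]mulr1.
Qed.

(** Split the increment as $[f(x+h(v+w)) - f(x+hv)] + [f(x+hv) - f(x)]$ and use
    the mean value theorem on the first bracket, where continuity of the derivative
    along $w$ gives the limit.  Iterating adds one direction at a time. *)
Lemma is_derive_dirD (R : realType) (V : normedModType R) (f : V -> R)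
    (x v w : V) (d : R) :
  (\forall y \near x, derivable f y w) -> {for x, continuous ('D_w f)} ->
  is_derive x v f d -> is_derive x (v + w) f (d + 'D_w f x).
Proof.
move=> dw cw dv.
suff H : (h^-1 *: (f (h *: (v + w) + x) - f x)) @[h --> 0^'] -->
    d + 'D_w f x.
  by split; [apply/cvg_ex; eexists; exact: H | exact: cvg_lim H].
have H1 : (h^-1 *: (f (h *: v + x) - f x)) @[h --> 0^'] --> d.
  by case: dv => dv <-.
suff H2 : (h^-1 *: (f (h *: (v + w) + x) - f (h *: v + x))) @[h --> 0^'] -->
    'D_w f x.
  rewrite (_ : (fun h => _) = (fun h => h^-1 *: (f (h *: v + x) - f x)) \+
      (fun h => h^-1 *: (f (h *: (v + w) + x) - f (h *: v + x)))).
    exact: cvgD.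
  by apply/funext => h /=; rewrite -[in RHS]scalerDr [in RHS]addrC subrKA.
apply/cvgrPdist_lt => e e0.
have : \forall y \near x, derivable f y w /\ `|'D_w f x - 'D_w f y| < e.
  by near=> y; split; near: y => //; exact: (cvgrPdist_lt _ _).1 cw e e0.
move=> /nbhs_ballP[r /= r0 Hr].
have M0 : 0 < `|v| + `|w| + 1 by rewrite ltr_wpDl// addr_ge0.
near=> h.
have h0 : h != 0 by near: h; exact: nbhs_dnbhs_neq.
have hr : `|h| * (`|v| + `|w| + 1) < r.
  rewrite -ltr_pdivlMr//; near: h; apply: dnbhs0_lt; exact: divr_gt0.
(* every point used below, also those given by the mean value theorem, is of
   this form *)
have inball (t : R) : `|t| <= `|h| -> ball x r (t *: w + (h *: v + x)).
  move=> th; rewrite -ball_normE /ball_/= addrA opprD addrCA subrr addr0 normrN.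
  apply: le_lt_trans hr; rewrite (le_trans (ler_normD _ _))// !normrZ.
  rewrite !mulrDr mulr1 addrC -addrA lerD2l.
  by rewrite (le_trans (ler_wpM2r _ th))// lerDl.
have dg (t : R) : `|t| <= `|h| -> is_derive t 1 (fun k : R => f (k *: w + (h *: v + x)))
    ('D_w f (t *: w + (h *: v + x))).
  move=> th; apply/is_derive_lineE; apply/derivableP.
  by have [] := Hr _ (inball t th).
have itv (a b t : R) : t \in `[a, b] -> `|a| <= `|h| -> `|b| <= `|h| -> `|t| <= `|h|.
  rewrite in_itv/= !ler_norml => /andP[ta tb] /andP[a1 a2] /andP[b1 b2].
  by rewrite (le_trans a1)//= (le_trans tb).
have mvt (a b : R) : a <= b -> `|a| <= `|h| -> `|b| <= `|h| ->
   exists2 c, `|c| <= `|h| & f (b *: w + (h *: v + x)) - f (a *: w + (h *: v + x))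
     = 'D_w f (c *: w + (h *: v + x)) * (b - a).
  move=> ab ah bh.
  have [||c cab ->] := @MVT_segment _ (fun k : R => f (k *: w + (h *: v + x)))
    (fun c => 'D_w f (c *: w + (h *: v + x))) _ _ ab.
  - move=> t /subset_itv_oo_cc tab; apply: dg; exact: itv tab ah bh.
  - apply: derivable_within_continuous => t tab.
    by have [] := dg t (itv _ _ _ tab ah bh).
  - by exists c => //; exact: itv cab ah bh.
have [c ch ->] : exists2 c, `|c| <= `|h| &
    h^-1 *: (f (h *: (v + w) + x) - f (h *: v + x)) =
    'D_w f (c *: w + (h *: v + x)).
  have -> : h *: (v + w) + x = h *: w + (h *: v + x).
    by rewrite scalerDr addrAC addrC addrA.
  have {2}-> : h *: v + x = 0 *: w + (h *: v + x) by rewrite scale0r add0r.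
  have [h_ge0|h_lt0] := leP 0 h.
    have [||c ch ->] := mvt 0 h h_ge0; rewrite ?normr0//.
    by exists c; rewrite // subr0 [_ *: _]mulrC mulfK.
  have [||c ch E] := mvt h 0 (ltW h_lt0); rewrite ?normr0//.
  exists c => //; rewrite -opprB E sub0r mulrN opprK.
  by rewrite [_ *: _]mulrC mulfK.
by have [] := Hr _ (inball c ch).
Unshelve. all: by end_near. Qed.

(** Decompose [v] on the canonical basis and add the coordinates one by one. *)
Lemma Ck1_is_derive (R : realType) n (A : set 'rV[R]_n) (f : 'rV[R]_n -> R)
    (x v : 'rV[R]_n) :
  open A -> Ck 1 A f -> A x ->
  is_derive x v f (\sum_(i < n) v ord0 i * partial i f x).
Proof.
move=> oA [_ C1f] Ax; rewrite {1}[v]row_sum_delta.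
have Anear : \forall y \near x, A y by exact: open_nbhs_nbhs.
elim: (index_enum 'I_n) => [|i s IHs].
  by rewrite !big_nil; exact: is_derive0.
have [dfi [+ _]] := C1f i; rewrite continuous_open_subspace// => cfi.
have dir y : A y -> is_derive y (v ord0 i *: delta_mx ord0 i) f
    (v ord0 i * partial i f y).
  by move=> Ay; apply: is_derive_scale_dir; apply: derivableP; exact: dfi.
rewrite !big_cons addrC [X in is_derive _ _ _ X]addrC.
rewrite -(@derive_val _ _ _ _ _ _ _ (dir x Ax)).
apply: is_derive_dirD => //.
  by apply: filterS Anear => y Ay; have [] := dir y Ay.
rewrite /prop_for /continuous_at (@derive_val _ _ _ _ _ _ _ (dir x Ax)).
have cvi : (v ord0 i * partial i f y) @[y --> x] --> v ord0 i * partial i f x.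
  apply: (@continuousM _ _ (cst (v ord0 i)) (partial i f)).
    exact: cst_continuous.
  exact: cfi x (mem_set Ax).
have E : \forall y \near x,
    v ord0 i * partial i f y = 'D_(v ord0 i *: delta_mx ord0 i) f y.
  near=> y; have /dir dy : A y by near: y.
  by rewrite (@derive_val _ _ _ _ _ _ _ dy).
exact: cvg_trans (near_eq_cvg E) cvi.
Unshelve. all: by end_near. Qed.

(** Were $d > 0$, the slope [g] would be positive just after [x] along the line,
    as it vanishes at [x]; the mean value theorem would then make [f] exceed its
    maximum. *)
Lemma second_derivative_test (R : realType) (V : normedModType R)
    (f g : V -> R) (x v : V) (d : R) :
  (\forall y \near x, is_derive y v f (g y)) ->
  (\forall y \near x, f y <= f x) ->
  is_derive x v g d -> g x = 0 /\ d <= 0.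
Proof.
move=> df maxf dg.
have [r /= r0 Hr] : exists2 r : R, 0 < r & forall t : R, `|t| < r ->
    is_derive t 1 (fun k : R => f (k *: v + x)) (g (t *: v + x)) /\
    f (t *: v + x) <= f x.
  have /nbhs_ballP[r /= r0 Hr] :
      \forall y \near x, is_derive y v f (g y) /\ f y <= f x.
    by near=> y; split; near: y.
  have M0 : 0 < `|v| + 1 by rewrite ltr_wpDl.
  exists (r / (`|v| + 1)); first exact: divr_gt0.
  move=> t; rewrite ltr_pdivlMr// => tr.
  have [|dt ft] := Hr (t *: v + x).
    rewrite -ball_normE /ball_/= opprD addrCA subrr addr0 normrN normrZ.
    by apply: le_lt_trans tr; rewrite ler_wpM2l// lerDl.
  by split => //; apply/is_derive_lineE.
have itvr t : t \in `](- r), r[ -> `|t| < r by rewrite in_itv/= ltr_norml.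
have itv0 : (0 : R) \in `](- r), r[ by rewrite in_itv/= oppr_lt0 r0.
have gx0 : g x = 0.
  have D0 : is_derive (0 : R) 1 (fun k : R => f (k *: v + x)) 0.
    apply: (@derive1_at_max _ _ (- r) r) => //.
    - by rewrite (le_trans _ (ltW r0))// oppr_le0 ltW.
    - by move=> t /itvr/Hr[[]].
    - by move=> t /itvr/Hr[_]; rewrite scale0r add0r.
  have [D1 _] := Hr 0 (itvr _ itv0).
  rewrite -(@derive_val _ _ _ _ _ _ _ D0) (@derive_val _ _ _ _ _ _ _ D1).
  by rewrite scale0r add0r.
split=> //; rewrite leNgt; apply/negP => d0.
have : (h^-1 *: (g (h *: v + x) - g x)) @[h --> 0^'] --> d.
  by case: dg => dg <-.
move=> /cvgrPdist_lt /(_ d d0).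
rewrite /dnbhs near_withinE => /nbhs_ballP[e /= e0 He].
pose b := Num.min e r / 2.
have m0 : 0 < Num.min e r by rewrite lt_min e0.
have b0 : 0 < b by rewrite divr_gt0.
have blt : b < Num.min e r by rewrite ltr_pdivrMr// ltr_pMr// ltr1n.
have br : b < r by rewrite (lt_le_trans blt)// ge_min lexx orbT.
have be : b < e by rewrite (lt_le_trans blt)// ge_min lexx.
have nb c : 0 <= c -> c <= b -> `|c| < r.
  by move=> c0 cb; rewrite ger0_norm// (le_lt_trans cb).
have H1 t : t \in `]0, b[ -> is_derive t 1 (fun k : R => f (k *: v + x)) (g (t *: v + x)).
  by rewrite in_itv/= => /andP[t0 tb]; have [] := Hr t (nb t (ltW t0) (ltW tb)).
have H2 : {within `[0, b], continuous (fun k : R => f (k *: v + x))}.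
  apply: derivable_within_continuous => t; rewrite in_itv/= => /andP[t0 tb].
  by have [[]] := Hr t (nb t t0 tb).
have [c /= + E] := MVT b0 H1 H2; rewrite in_itv/= => /andP[c0 cb].
have gc : 0 < g (c *: v + x).
  have := He c; rewrite -ball_normE /ball_/= sub0r normrN gtr0_norm//.
  move=> /(_ (lt_trans cb be)); rewrite gt_eqF// => /(_ isT).
  rewrite gx0 subr0 => /ltr_normlP[_].
  by rewrite gtrBl [_ *: _]mulrC pmulr_lgt0 ?invr_gt0.
have [_] := Hr b (nb b (ltW b0) (lexx b)).
rewrite -subr_le0 -{2}[x]add0r -(scale0r v) E subr0 leNgt.
by rewrite mulr_gt0.
Unshelve. all: by end_near. Qed.

(** * The operator in nondivergence form *)

Lemma enorm_sqr (R : realType) n (v : 'rV[R]_n) :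
  enorm v ^+ 2 = \sum_(i < n) v ord0 i ^+ 2.
Proof. by rewrite sqr_sqrtr// sumr_ge0// => i _; exact: sqr_ge0. Qed.

(** The two fluxes in [Q] are the cases $c = -1$ and $c = 1$ of one computation:
    $D(q^{-1/2}) = -\frac12 q^{-3/2} Dq$ with $q = 1 + c|Du|^2$. *)
Lemma divergence_flux (R : realType) n (u : 'rV[R]_n -> R) (x : 'rV[R]_n)
    (c : R) :
  (forall i j, derivable (partial j u) x (delta_mx ord0 i)) ->
  0 < 1 + c * enorm (grad u x) ^+ 2 ->
  let S := Num.sqrt (1 + c * enorm (grad u x) ^+ 2) in
  divergence (fun y => (Num.sqrt (1 + c * enorm (grad u y) ^+ 2))^-1 *: grad u y) x
  = S^-1 * (\sum_i partial i (partial i u) x)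
    - c * S^-1 ^+ 3 * (\sum_i partial i u x *
        \sum_j partial j u x * partial i (partial j u) x).
Proof.
move=> du q0 S.
have S0 : 0 < S by rewrite sqrtr_gt0.
pose q := fun y => 1 + c * \sum_(k < n) partial k u y ^+ 2.
have qE y : 1 + c * enorm (grad u y) ^+ 2 = q y.
  by rewrite enorm_sqr; congr (_ + _ * _); apply: eq_bigr => k _; rewrite mxE.
have qx0 : 0 < q x by rewrite -qE.
have SE : Num.sqrt (q x) = S by rewrite /S qE.
rewrite /divergence !mulr_sumr -sumrB; apply: eq_bigr => i _.
rewrite [LHS]/partial; apply: derive_val.
have dq : is_derive x (delta_mx ord0 i) q
    (c * (2 * \sum_j partial j u x * partial i (partial j u) x)).
  have dk k : is_derive x (delta_mx ord0 i) (fun y => partial k u y ^+ 2)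
      (2 * (partial k u x * partial i (partial k u) x)).
    rewrite -[fun _ => _]/(partial k u ^+ 2).
    have dp := derivableP (du i k).
    have dp2 := is_deriveX 2 dp.
    apply: is_derive_eq dp2 _.
    by rewrite mulrA.
  have -> : q = cst 1 + c *: (\sum_k (fun y => partial k u y ^+ 2)).
    apply/funext => y.
    by rewrite /q /= !fctE fct_sumE.
  have ds := is_deriveD (is_derive_cst (1 : R) x (delta_mx ord0 i))
    (is_deriveZ c (is_derive_sum dk)).
  by apply: is_derive_eq ds _; rewrite add0r mulr_sumr.
have dS : is_derive x (delta_mx ord0 i) (fun y => (Num.sqrt (q y))^-1)
    (- c * S^-1 ^+ 3 * \sum_j partial j u x * partial i (partial j u) x).
  have dV : is_derive (q x) 1 (fun t => (Num.sqrt t)^-1)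
      (- S ^- 2 * (2 * S)^-1).
    have := is_derive1_sqrt qx0; rewrite SE => dsq.
    have sq0 : Num.sqrt (q x) != 0 by rewrite SE gt_eqF.
    by have := is_deriveV sq0 dsq; rewrite SE.
  have := is_derive_comp_real dV dq.
  by move=> D; apply: is_derive_eq D _; field; rewrite gt_eqF.
have -> : (fun y => ((Num.sqrt (1 + c * enorm (grad u y) ^+ 2))^-1 *: grad u y) ord0 i)
   = (fun y => (Num.sqrt (q y))^-1) * partial i u.
  by apply/funext => y; rewrite qE !mxE.
have dp := derivableP (du i i).
apply: is_derive_eq.
have alg (a p s k b : R) : s * a + p * (- c * k * b) = s * a - c * k * (p * b).
  by ring.
by rewrite SE; exact: alg.
Qed.

Lemma Q_expand (R : realType) (u : 'rV[R]_2 -> R) (x : 'rV[R]_2) :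
  (forall i j, derivable (partial j u) x (delta_mx ord0 i)) ->
  enorm (grad u x) < 1 ->
  let S := Num.sqrt (1 - enorm (grad u x) ^+ 2) in
  let T := Num.sqrt (1 + enorm (grad u x) ^+ 2) in
  Q u x = (S^-1 - T^-1) * (\sum_i partial i (partial i u) x)
    + (S^-1 ^+ 3 + T^-1 ^+ 3) * (\sum_i partial i u x *
        \sum_j partial j u x * partial i (partial j u) x).
Proof.
move=> du u1 S T.
have e0 : 0 <= enorm (grad u x) by exact: sqrtr_ge0.
have SE y : 1 - enorm (grad u y) ^+ 2 = 1 + (-1) * enorm (grad u y) ^+ 2.
  by rewrite mulN1r.
have TE y : 1 + enorm (grad u y) ^+ 2 = 1 + 1 * enorm (grad u y) ^+ 2.
  by rewrite mul1r.
rewrite /Q /S /T; under eq_fun do rewrite SE.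
rewrite SE; under [in X in _ - X]eq_fun do rewrite TE.
rewrite TE !divergence_flux//.
- by ring.
- by rewrite mulN1r subr_gt0 expr_lt1.
- by rewrite mul1r ltr_pwDl// sqr_ge0.
Qed.

Lemma sum_delta (R : realType) n (i : 'I_n) (F : 'I_n -> R) :
  \sum_(j < n) (delta_mx ord0 i : 'rV[R]_n) ord0 j * F j = F i.
Proof.
rewrite (bigD1 i)//= big1 ?addr0 => [|j /negbTE ji]; first by rewrite mxE !eqxx mul1r.
by rewrite mxE eqxx ji mul0r.
Qed.

(** As $S < T$ away from $p = 0$, the trace enters with a nonnegative
    coefficient; the strict sign comes from the quadratic form evaluated at
    $p$ itself.  The factor [s] treats maxima and minima together. *)
Lemma Q_neg_of_hessian_neg (R : realType) (u : 'rV[R]_2 -> R) (x : 'rV[R]_2) (s e : R) :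
  (forall i j, derivable (partial j u) x (delta_mx ord0 i)) ->
  enorm (grad u x) < 1 -> grad u x != 0 -> 0 < e ->
  (forall h : 'rV[R]_2, s * (\sum_i h ord0 i *
      \sum_j h ord0 j * partial i (partial j u) x)
    <= - e * \sum_i h ord0 i ^+ 2) ->
  s * Q u x < 0.
Proof.
move=> du u1 p0 e0 Hneg; rewrite Q_expand//.
set E := enorm (grad u x) in u1 *.
have E0 : 0 < E.
  rewrite lt_neqAle sqrtr_ge0 andbT eq_sym; apply: contra p0 => /eqP E0.
  have : \sum_(i < 2) (grad u x) ord0 i ^+ 2 = 0 by rewrite -enorm_sqr -/E E0 expr0n.
  move/eqP; rewrite psumr_eq0; last by move=> i _; exact: sqr_ge0.
  move=> /allP pz; apply/eqP/rowP => i.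
  by have := pz i (mem_index_enum i); rewrite /= sqrf_eq0 => /eqP ->; rewrite mxE.
have ST : 0 < Num.sqrt (1 - E ^+ 2) by rewrite sqrtr_gt0 subr_gt0 expr_lt1// ltW.
have TT : 0 < Num.sqrt (1 + E ^+ 2) by rewrite sqrtr_gt0 ltr_pwDl// sqr_ge0.
have le_ST : Num.sqrt (1 - E ^+ 2) <= Num.sqrt (1 + E ^+ 2).
  by rewrite ler_wsqrtr// lerD2l (le_trans _ (sqr_ge0 E))// oppr_le0 sqr_ge0.
set S := Num.sqrt (1 - _) in ST le_ST *; set T := Num.sqrt (1 + _) in TT le_ST *.
have trace_neg : s * (\sum_i partial i (partial i u) x) <= 0.
  rewrite mulr_sumr; apply: sumr_le0 => i _.
  have := Hneg (delta_mx ord0 i).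
  (* exactly two sums: the squares on the right, unfolded, match as well *)
  rewrite sum_delta sum_delta => /le_trans; apply.
  by rewrite mulNr oppr_le0 mulr_ge0 ?(ltW e0)// sumr_ge0// => j _; exact: sqr_ge0.
have quad_neg : s * (\sum_i partial i u x *
    \sum_j partial j u x * partial i (partial j u) x) < 0.
  have := Hneg (grad u x); rewrite -enorm_sqr -/E.
  under eq_bigr do (rewrite mxE; under eq_bigr do rewrite mxE).
  by move=> /le_lt_trans; apply; rewrite mulNr oppr_lt0 mulr_gt0// exprn_gt0.
rewrite mulrDr !(mulrCA s); apply: ltr_wnDl.
  by rewrite mulr_ge0_le0// subr_ge0 lef_pV2.
by rewrite pmulr_rlt0// addr_gt0// exprn_gt0 ?invr_gt0.
Qed.

(** * Comparison with affine functions *)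

Lemma is_derive_coord (R : realType) n (x h : 'rV[R]_n) (i : 'I_n) :
  is_derive x h (fun y => y ord0 i) (h ord0 i).
Proof.
have := is_derive_lineE (fun y : 'rV[R]_n => y ord0 i) x h 0 (h ord0 i).
rewrite scale0r add0r => -[+ _]; apply.
have -> : (fun k : R => (k *: h + x) ord0 i) = h ord0 i *: id + cst (x ord0 i).
  by apply/funext => k; rewrite !mxE [k * _]mulrC.
by apply: is_derive_eq; rewrite addr0 [_ *: _]mulr1.
Qed.

(** Affine comparison functions are absorbed in [b] up to an additive constant,
    which does not move the maximum point.  The partial derivatives in the
    quadratic form are nested in the order met in [Q_expand]; differentiating
    twice along [h] yields the opposite order, and a renaming of the summation
    indices exchanges the two. *)
Lemma paraboloid_contact (R : realType) n (A : set 'rV[R]_n)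
    (u : 'rV[R]_n -> R) (s eps : R) (b x : 'rV[R]_n) :
  open A -> Ck 2 A u -> A x ->
  let w y := s * u y + \sum_(i < n) (eps * y ord0 i ^+ 2 + b ord0 i * y ord0 i) in
  (forall y, A y -> w y <= w x) ->
  (forall i, s * partial i u x = - (2 * eps * x ord0 i + b ord0 i)) /\
  (forall h : 'rV[R]_n, s * (\sum_(i < n) h ord0 i *
      \sum_(j < n) h ord0 j * partial i (partial j u) x)
    <= - (2 * eps) * \sum_(i < n) h ord0 i ^+ 2).
Proof.
move=> oA [cu C2u] Ax w wmax.
have Anear : \forall y \near x, A y by exact: open_nbhs_nbhs.
have C1u : Ck 1 A u.
  by split=> // i; have [d [c _]] := C2u i; split.
have C1p i : Ck 1 A (partial i u) by have [_ ?] := C2u i.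
pose g (h y : 'rV[R]_n) := s * (\sum_(i < n) h ord0 i * partial i u y) +
   \sum_(i < n) (2 * eps * y ord0 i + b ord0 i) * h ord0 i.
have dw (h y : 'rV[R]_n) : A y -> is_derive y h w (g h y).
  move=> Ay; have du := Ck1_is_derive h oA C1u Ay.
  have dq i : is_derive y h (fun y => eps * y ord0 i ^+ 2 + b ord0 i * y ord0 i)
      ((2 * eps * y ord0 i + b ord0 i) * h ord0 i).
    have di := is_derive_coord y h i.
    have D := is_deriveD (is_deriveZ eps (is_deriveX 2 di)) (is_deriveZ (b ord0 i) di).
    apply: is_derive_eq D _ => /=.
    have alg (e t k c : R) : e * (2 * t * k) + c * k = (2 * e * t + c) * k by ring.
    exact: alg.
  have D := is_deriveD (is_deriveZ s du) (is_derive_sum dq).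
  have -> : w = s *: u + \sum_i (fun y : 'rV[R]_n => eps * y ord0 i ^+ 2 + b ord0 i * y ord0 i).
    by apply/funext => t; rewrite !fctE fct_sumE.
  exact: D.
have dg (h : 'rV[R]_n) : is_derive x h (g h)
   (s * (\sum_(i < n) h ord0 i * \sum_(j < n) h ord0 j * partial j (partial i u) x)
     + 2 * eps * \sum_(i < n) h ord0 i ^+ 2).
  have dp i : is_derive x h (fun y => h ord0 i * partial i u y)
      (h ord0 i * \sum_(j < n) h ord0 j * partial j (partial i u) x).
    have dpi := Ck1_is_derive h oA (C1p i) Ax.
    have D := is_deriveZ (h ord0 i) dpi.
    exact: D.
  have dq i : is_derive x h (fun y => (2 * eps * y ord0 i + b ord0 i) * h ord0 i)
      (2 * eps * h ord0 i ^+ 2).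
    have di := is_derive_coord x h i.
    have D := is_deriveZ (h ord0 i)
      (is_deriveD (is_deriveZ (2 * eps) di) (is_derive_cst (b ord0 i) x h)).
    have -> : (fun y : 'rV[R]_n => (2 * eps * y ord0 i + b ord0 i) * h ord0 i) =
       h ord0 i *: (2 * eps *: (fun y : 'rV[R]_n => y ord0 i) + cst (b ord0 i)).
      by apply/funext => y; rewrite mulrC.
    apply: is_derive_eq D _.
    by rewrite addr0 [LHS]mulrC expr2 mulrA.
  have D := is_deriveD (is_deriveZ s (is_derive_sum dp)) (is_derive_sum dq).
  have -> : g h = s *: (\sum_i (fun y : 'rV[R]_n => h ord0 i * partial i u y)) +
      \sum_i (fun y : 'rV[R]_n => (2 * eps * y ord0 i + b ord0 i) * h ord0 i).
    by apply/funext => y; rewrite /g !fctE !fct_sumE.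
  by apply: is_derive_eq D _; rewrite -mulr_sumr.
have test (h : 'rV[R]_n) : g h x = 0 /\
   s * (\sum_(i < n) h ord0 i * \sum_(j < n) h ord0 j * partial j (partial i u) x)
     + 2 * eps * \sum_(i < n) h ord0 i ^+ 2 <= 0.
  apply: second_derivative_test (dg h); apply: filterS Anear => y Ay.
    exact: dw.
  exact: wmax.
split=> [i|h].
  have [+ _] := test (delta_mx ord0 i).
  rewrite /g sum_delta; under eq_bigr do rewrite mulrC.
  by rewrite sum_delta => /eqP; rewrite addr_eq0 => /eqP.
have [_ hess] := test h.
have sym : \sum_(i < n) h ord0 i * (\sum_(j < n) h ord0 j * partial i (partial j u) x)
  = \sum_(i < n) h ord0 i * (\sum_(j < n) h ord0 j * partial j (partial i u) x).
  transitivity (\sum_(i < n) \sum_(j < n)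
      h ord0 i * (h ord0 j * partial i (partial j u) x)).
    by apply: eq_bigr => i _; rewrite mulr_sumr.
  rewrite exchange_big/=; apply: eq_bigr => j _; rewrite mulr_sumr.
  by apply: eq_bigr => i _; rewrite mulrCA.
by rewrite sym mulNr -subr_le0 opprK.
Qed.

Lemma coord_le_norm (R : realType) n (x : 'rV[R]_n) (i : 'I_n) :
  `|x ord0 i| <= `|x|.
Proof.
rewrite [leRHS]/Num.Def.normr/= mx_normrE.
exact: (le_bigmax _ _ (ord0, i)).
Qed.

Lemma bounded_closure (R : realType) n (A : set 'rV[R]_n) :
  bounded_set A -> bounded_set (closure A).
Proof.
move=> [M [Mreal MA]]; exists M; split => // N MN x clx.
have cN : closed [set y : 'rV[R]_n | `|y| <= N].
  apply: (@preimage_closed _ _ (fun y : 'rV[R]_n => `|y|) [set t | t <= N]).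
    by move=> y _; exact: norm_continuous.
  exact: closed_le.
have : closure [set y : 'rV[R]_n | `|y| <= N] x.
  by apply: closureS clx => y Ay; exact: MA.
by move/closure_id: cN => <-.
Qed.

(** The weak maximum principle for [u] against an affine function.  The equation
    degenerates where [Du] vanishes, so the usual perturbation $\varepsilon|x|^2$
    is tilted by a linear term which forces [Du] to be nonzero at the contact
    point. *)
Lemma one_sided_comparison (R : realType) (Omega : set 'rV[R]_2)
    (u : 'rV[R]_2 -> R) (a : 'rV[R]_2) (c s : R) :
  open Omega -> bounded_set Omega -> Ck 2 Omega u ->
  {within closure Omega, continuous u} ->
  (forall x, Omega x -> Q u x = 0) ->
  (forall x, Omega x -> enorm (grad u x) < 1) ->
  let v x := s * (u x - (\sum_(i < 2) a ord0 i * x ord0 i + c)) in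
  (forall x, boundary Omega x -> v x <= 0) ->
  forall x, closure Omega x -> v x <= 0.
Proof.
move=> oO bO C2u C0u Qu0 u1 v vbd x0 clx0; rewrite leNgt; apply/negP => m0.
set m := v x0 in m0.
have [K K1 HK] : exists2 K : R, 1 <= K & forall x i, closure Omega x ->
    `|x ord0 i| <= K.
  have [M [_ MA]] := bounded_closure bO.
  exists (Num.max 1 (M + 1)); first by rewrite le_max lexx.
  move=> x i clx; rewrite (le_trans (coord_le_norm _ _))//.
  rewrite le_max; apply/orP; right.
  by apply: MA clx; rewrite ltrDl.
have K0 : 0 < K by rewrite (lt_le_trans ltr01).
(* the perturbation is at most 6 eps K^2 in absolute value, hence the values at
   x0 and on the boundary still differ by at least m - 12 eps K^2 = m / 2 *)
have [eps eps0 epsE] : exists2 eps : R, 0 < eps & 24 * (eps * K ^+ 2) = m.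
  exists (m / (24 * K ^+ 2)); last by field; rewrite gt_eqF.
  by rewrite divr_gt0// mulr_gt0// exprn_gt0.
(* same sign for s * a_0 and - k: they cannot cancel, and |k| exceeds
   2 eps |x_0| on the closure *)
pose k := if 0 <= s * a ord0 ord0 then - (4 * eps * K) else 4 * eps * K.
pose b : 'rV[R]_2 := \row_i (k *+ (i == ord0) - s * a ord0 i).
pose w y := s * u y + \sum_(i < 2) (eps * y ord0 i ^+ 2 + b ord0 i * y ord0 i).
have wE y : w y = v y + s * c +
    (eps * y ord0 ord0 ^+ 2 + eps * y ord0 ord_max ^+ 2 + k * y ord0 ord0).
  rewrite /w /v !big_ord_recl !big_ord0 !mxE /= mulr1n mulr0n.
  rewrite (_ : lift ord0 ord0 = ord_max); last exact: val_inj.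
  ring.
have kpos : 0 < 4 * eps * K.
  by apply: mulr_gt0 => //; apply: mulr_gt0.
have pertle y : closure Omega y ->
   `|eps * y ord0 ord0 ^+ 2 + eps * y ord0 ord_max ^+ 2 + k * y ord0 ord0|
     <= 6 * (eps * K ^+ 2).
  move=> cly.
  have sq i : `|eps * y ord0 i ^+ 2| <= eps * K ^+ 2.
    rewrite normrM (gtr0_norm eps0) ler_wpM2l ?(ltW eps0)// normrX.
    by rewrite lerXn2r ?nnegrE ?(ltW K0)//; exact: HK.
  have lin : `|k * y ord0 ord0| <= 4 * (eps * K ^+ 2).
    rewrite normrM (_ : `|k| = 4 * eps * K); last first.
      by rewrite /k; case: ifP => _; rewrite ?normrN gtr0_norm.
    by rewrite expr2 !mulrA; apply: ler_wpM2l; [exact: ltW|exact: HK].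
  rewrite (le_trans (ler_normD _ _))//.
  rewrite (le_trans (lerD (ler_normD _ _) lin))//.
  have := lerD (sq ord0) (sq ord_max); lra.
have cw : {within closure Omega, continuous w}.
  have -> : w = (s \*: u) \+ (fun y => \sum_(i < 2)
     (eps * y ord0 i ^+ 2 + b ord0 i * y ord0 i)) by [].
  have cq : continuous (fun y : 'rV[R]_2 => \sum_(i < 2)
     (eps * y ord0 i ^+ 2 + b ord0 i * y ord0 i)).
    move=> y; rewrite (_ : (fun _ => _) = \sum_(i < 2)
        (eps *: (fun y : 'rV[R]_2 => y ord0 i) ^+ 2 +
         b ord0 i *: (fun y : 'rV[R]_2 => y ord0 i))); last first.
      by apply/funext => t; rewrite fct_sumE.
    apply: differentiable_continuous; apply: differentiable_sum => i.
    have di := differentiable_coord y ord0 i.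
    apply: differentiableD; apply: differentiableZ => //.
    exact: differentiableX.
  move=> y; apply: continuousD; last exact: continuous_subspaceT.
  apply: (@continuousM _ (subspace (closure Omega)) (cst s) u); first exact: cst_continuous.
  exact: C0u.
have cK : compact (closure Omega).
  by apply: bounded_closed_compact; [exact: bounded_closure|exact: closed_closure].
have [x1 clx1 x1max] := EVT_max_rV (ex_intro _ x0 clx0) cK cw.
rewrite inE in clx1.
have Ox1 : Omega x1.
  have [|nb] := pselect (boundary Omega x1).
    move=> bd1; have := x1max x0 (mem_set clx0); rewrite !wE.
    have := pertle _ clx0; have := pertle _ clx1.
    rewrite !ler_norml => /andP[_ p1] /andP[p2 _].
    by have := vbd _ bd1; rewrite -/m; lra.
  have : interior Omega x1.
    by apply: contrapT => nint; apply: nb; split.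
  exact: interior_subset.
have [grad0 hess] := paraboloid_contact oO C2u Ox1
  (fun y Oy => x1max y (mem_set (subset_closure Oy))).
have [_ C1p] := C2u.
have : s * Q u x1 < 0.
  apply: (@Q_neg_of_hessian_neg _ u x1 s (2 * eps)) => //.
  - by move=> i j; have [_ [_ /(_ i) [d _]]] := C1p j; exact: d.
  - exact: u1.
  - apply/eqP => gu0; have := grad0 ord0.
    have -> : partial ord0 u x1 = 0.
      by have /rowP/(_ ord0) := gu0; rewrite !mxE.
    have := HK x1 ord0 clx1; rewrite ler_norml => /andP[xl xu].
    have eK : 0 < eps * K by rewrite mulr_gt0.
    have e1 : eps * x1 ord0 ord0 <= eps * K by rewrite ler_pM2l.
    have e2 : - (eps * K) <= eps * x1 ord0 ord0 by rewrite -mulrN ler_pM2l.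
    rewrite mxE eqxx mulr1n mulr0 /k; case: ifPn => [sa|]; last rewrite -ltNge => sa.
      lra.
    lra.
  - by rewrite mulr_gt0.
by rewrite Qu0// mulr0 ltxx.
Qed.

Theorem theorem10 (R : realType) (Omega : set 'rV[R]_2)
    (psi u : 'rV[R]_2 -> R)
    (domO : is_domain Omega) (bndO : bounded_set Omega)
    (psi_cont : {within boundary Omega, continuous psi})
    (psi_aff : restricts_affine (boundary Omega) psi)
    (u_C2 : Ck 2 Omega u)
    (u_C0 : {within closure Omega, continuous u})
    (u_sol : forall x, Omega x -> Q u x = 0)
    (u_grad : forall x, Omega x -> enorm (grad u x) < 1)
    (u_bd : forall x, boundary Omega x -> u x = psi x) :
  restricts_affine (closure Omega) u.
Proof.
have [oO _] := domO; have [l [a [c lE]] psil] := psi_aff.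
exists l; first by exists a, c.
have side s x : closure Omega x -> s * (u x - l x) <= 0.
  rewrite lE; apply: one_sided_comparison => // y bdy.
  by rewrite u_bd// psil ?inE// lE subrr mulr0.
move=> x; rewrite inE => clx; apply/eqP; rewrite -subr_eq0 eq_le.
have := side 1 x clx; have := side (-1) x clx.
by rewrite mul1r mulN1r oppr_le0 => -> ->.
Qed.
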